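(* Let $(v_{s,t})_{(s,t)\in\Delta}$ be an absolutely continuous reverse evolution family in $\mathbb H$ contained in $\mathcal{BF}_0$, with associated Herglotz vector field $\phi$, and suppose $\int_0^{+\infty}\phi''(\infty,t)\,\mathrm dt=+\infty$. Then for every $s\ge0$, $\lim_{t\to\infty}v_{s,t}(\infty)=0$; consequently, for the branching process $(Z_t)$ whose Laplace exponents are $(v_{s,t})$, $\mathbb P^{(s,x)}[T_0^s<\infty]=1$ for all $x>0$ and $s\ge0$.
   Context: $\Delta=\{(s,t):0\le s\le t\}$, $\mathbb H=\{\operatorname{Re}\zeta>0\}$; $L^1_{\rm loc}$: integrable on compact subintervals of $[0,\infty)$. $\mathcal{BF}$: Bernstein functions ($C^\infty$ $f:(0,\infty)\to\mathbb R$, $f\ge0$, $(-1)^{n-1}f^{(n)}\ge0$) not identically zero, extended holomorphically to $\mathbb H$. Denjoy–Wolff point of $v\in{\sf Hol}(\mathbb H,\mathbb H)$ (not ${\rm id}$, not an elliptic automorphism): the unique $\tau\in\overline{\mathbb H}\cup\{\infty\}$ with $v^{\circ n}\to\tau$ locally uniformly. $\mathcal{BF}_0$: ${\rm id}$ together with the $v\in\mathcal{BF}$ with Denjoy–Wolff point $0$. Absolutely continuous reverse evolution family: $v_{s,s}={\rm id}$, $v_{s,u}=v_{s,t}\circ v_{t,u}$, $|v_{s,u}(z)-v_{s,t}(z)|\le\int_t^uf_z$ with $f_z\in L^1_{\rm loc}$ nonnegative. Its associated Herglotz vector field is the (a.e. unique) $\phi$ with $\frac{\mathrm d}{\mathrm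 ds}v_{s,t}(\zeta)=\phi(v_{s,t}(\zeta),s)$ for a.e. $s\in[0,t]$; $\phi''$ denotes the second derivative in the spatial variable and $\phi''(\infty,t):=\lim_{\theta\to+\infty}\phi''(\theta,t)$ (it exists and is $\ge0$ for a.e. $t$). $v_{s,t}(\infty):=\lim_{\theta\to+\infty}v_{s,t}(\theta)$. A branching process on $[0,\infty]$ with Laplace exponents $(v_{s,t})$ is a Markov family $(Z_t)$ with probabilities $\mathbb P^{(s,x)}$ whose transition kernels $k_{s,t}$ satisfy $\int_{[0,\infty)}e^{-\theta y}k_{s,t}(x,\mathrm dy)=e^{-xv_{s,t}(\theta)}$ (plus $k_{s,t}(0,\cdot)=\delta_0$, $k_{s,t}(\infty,\cdot)=\delta_\infty$); here it is taken to be realized with sample paths in $D[0,\infty)$: càdlàg paths into $[0,\infty]$ that stay forever at $0$ (resp. $\infty$) once they or their left limits reach it. Extinction time: $T_0^s=\inf\{t\ge s:Z_t=0\}$. *)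

(* Defs.v *)
(* mathcomp-analysis over an abstract R : realType.
   Complex numbers: real_closed's R[i], viewed through the regular algebra
   R[i]^o, which carries the normed-module (hence topology, derivative)
   structure of mathcomp-analysis over the field R[i] itself, so that
   [derivable f z 1] is complex differentiability. *)
From HB Require Import structures.
From mathcomp Require Import all_boot all_order all_algebra.
From mathcomp Require Import all_classical all_reals all_analysis.
From mathcomp Require Import measurable_realfun complex.
Set Implicit Arguments.
Unset Strict Implicit.
Unset Printing Implicit Defensive.
Import Order.TTheory GRing.Theory Num.Theory.
Import numFieldNormedType.Exports.
Local Open Scope ring_scope.
Local Open Scope classical_set_scope.

Section Defs.
Variable R : realType.
Local Notation C := ((R[i])^o).

Definition RtoC (x : R) : C := Complex x 0.

Definition Hplane : set C := [set z | 0 < complex.Re z].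

Definition holomorphic_on (D : set C) (f : C -> C) : Prop :=
  forall z, D z -> derivable f z 1.

Definition HolHH (f : C -> C) : Prop :=
  holomorphic_on Hplane f /\ (forall z, Hplane z -> Hplane (f z)).

Definition bernstein (f : R -> R) : Prop :=
  [/\ (forall n x, 0 < x -> derivable (derive1n n f) x 1),
      (forall x, 0 < x -> 0 <= f x),
      (forall n x, (0 < n)%N -> 0 < x -> 0 <= (-1) ^+ n.-1 * derive1n n f x)
    & exists x, 0 < x /\ f x != 0].

Definition in_BF (v : C -> C) : Prop :=
  holomorphic_on Hplane v /\
  exists f, bernstein f /\ forall x, 0 < x -> v (RtoC x) = RtoC (f x).

Definition is_id_H (v : C -> C) : Prop := forall z, Hplane z -> v z = z.

Definition DW_point_zero (v : C -> C) : Prop :=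
  forall K : set C, K `<=` Hplane -> compact K ->
    {uniform K, (fun n => iter n v) @ \oo --> (fun _ => (0 : C))}.

Definition in_BF0 (v : C -> C) : Prop :=
  is_id_H v \/ (in_BF v /\ ~ is_id_H v /\ DW_point_zero v).

Definition reverse_evolution_family (v : R -> R -> C -> C) : Prop :=
  [/\ (forall s t, 0 <= s -> s <= t -> HolHH (v s t)),
      (forall s z, 0 <= s -> Hplane z -> v s s z = z)
    & (forall s t u z, 0 <= s -> s <= t -> t <= u -> Hplane z ->
         v s u z = v s t (v t u z))].

Definition abs_cont_family (v : R -> R -> C -> C) : Prop :=
  forall z, Hplane z -> exists fz : R -> R,
    [/\ (forall x, 0 <= x -> 0 <= fz x),
        (forall T, 0 <= T ->
           (lebesgue_measure : measure _ R).-integrable `[0, T] (EFin \o fz))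
      & (forall s t u, 0 <= s -> s <= t -> t <= u ->
           ((ComplexField.Normc.normc (v s u z - v s t z))%:E <=
            \int[lebesgue_measure]_(x in `[t, u]) (fz x)%:E)%E)].

Definition assoc_herglotz (v : R -> R -> C -> C) (phi : C -> R -> C) : Prop :=
  (forall s, 0 <= s -> holomorphic_on Hplane (phi^~ s)) /\
  forall t z, 0 <= t -> Hplane z ->
    {ae (lebesgue_measure : measure _ R), forall s, `[0, t] s ->
      [/\ derivable (fun r => complex.Re (v r t z)) s 1,
          derivable (fun r => complex.Im (v r t z)) s 1,
          'D_1 (fun r => complex.Re (v r t z)) s = complex.Re (phi (v s t z) s)
        & 'D_1 (fun r => complex.Im (v r t z)) s = complex.Im (phi (v s t z) s)]}.

Definition phi2 (phi : C -> R -> C) (t : R) (w : C) : C :=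
  'D_1 ('D_1 (phi^~ t)) w.

Definition phi2inf (phi : C -> R -> C) (t : R) : C :=
  lim (phi2 phi t (RtoC theta) @[theta --> +oo]).

Definition vinf (v : R -> R -> C -> C) (s t : R) : \bar R :=
  lim ((complex.Re (v s t (RtoC theta)))%:E @[theta --> +oo]).

Definition nat_gen d (Omega : measurableType d) (Z : R -> Omega -> \bar R)
    (s t : R) : set (set Omega) :=
  [set E | exists r (A : set (\bar R)), [/\ s <= r, r <= t, measurable A &
             E = Z r @^-1` A]].

Definition branching_process d (Omega : measurableType d)
    (P : R -> \bar R -> probability Omega R) (Z : R -> Omega -> \bar R)
    (v : R -> R -> C -> C) : Prop :=
  exists k : R -> R -> R.-pker (\bar R) ~> (\bar R),
  [/\
    (forall s t (x theta : R), 0 <= s -> s <= t -> 0 <= x -> 0 < theta ->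
       (\int[k s t (x%:E)]_(y in [set y : \bar R | (0 <= y < +oo)%E])
          (expR (- (theta * fine y)))%:E
       = (expR (- (x * complex.Re (v s t (RtoC theta)))))%:E)%E),
    (forall s t (A : set (\bar R)), 0 <= s -> s <= t -> measurable A ->
       k s t 0%E A = \d_(0%E) A /\ k s t +oo%E A = \d_(+oo%E) A),
    (forall t, 0 <= t -> measurable_fun setT (Z t)) /\
    (forall s (x : \bar R), 0 <= s -> (0 <= x)%E ->
       P s x [set w | Z s w = x] = 1%E),
    (forall s t u (x : \bar R) (F : set Omega) (B : set (\bar R)),
       0 <= s -> s <= t -> t <= u -> (0 <= x)%E ->
       <<s nat_gen Z s t >> F -> measurable B ->
       (P s x (F `&` Z u @^-1` B) = \int[P s x]_(w in F) k t u (Z t w) B)%E) &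
    (forall w,
      [/\ (forall t, 0 <= t -> (0 <= Z t w)%E),
          (forall t, 0 <= t -> Z r w @[r --> t^'+] --> Z t w),
          (forall t, 0 < t -> cvg (Z r w @[r --> t^'-])),
          (forall t, 0 <= t ->
             (Z t w = 0%E \/ (0 < t /\ lim (Z r w @[r --> t^'-]) = 0%E)) ->
             forall r, t <= r -> Z r w = 0%E)
        & (forall t, 0 <= t ->
             (Z t w = +oo%E \/ (0 < t /\ lim (Z r w @[r --> t^'-]) = +oo%E)) ->
             forall r, t <= r -> Z r w = +oo%E)])].

(* extinction time T_0^s = inf {t >= s : Z_t = 0} (inf of empty set = +oo) *)
Definition extinction_time d (Omega : measurableType d)
    (Z : R -> Omega -> \bar R) (s : R) (w : Omega) : \bar R :=
  ereal_inf [set r%:E | r in [set r | s <= r /\ Z r w = 0%E]].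

End Defs.

(* Main.v *)
(* On the positive axis every exponent [f] is a Bernstein function with [f x <= x],
   since its iterates tend to [0]; its third derivative being nonnegative, the gap
   quotient [(x - f x) / x ^+ 2] is nonincreasing. Differentiating in the starting
   time, [phi (x, s) / x ^+ 2] is nonincreasing in [x] for a.e. [s]; its limit at
   infinity is half of [phi2inf phi s], so the equation for [v_{s,t}] gives
     d/ds (- 2 / v_{s,t}(x)) >= phi2inf phi s   for a.e. s.
   The function [- 2 / v_{s,t}(x)] is monotone in [s], so integrating yields
     2 / v_{s,t}(x) >= int_s^t phi2inf phi r dr   for every x > 0,
   hence [v_{s,t}(oo)] tends to [0]. Letting [theta] tend to infinity in the Laplace
   transform, the probability of extinction by time [t] is at least
   [exp (- x v_{s,t}(oo))]. *)
Require Import Defs.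
From HB Require Import structures.
From mathcomp Require Import all_boot all_order all_algebra.
From mathcomp Require Import all_classical all_reals all_analysis.
From mathcomp Require Import measurable_realfun complex.
From mathcomp Require Import ring lra.
Import Order.TTheory GRing.Theory Num.Theory.
Import numFieldNormedType.Exports.
Local Open Scope ring_scope.
Local Open Scope classical_set_scope.

(** * Integrating a lower bound on the derivative of a monotone function *)

Lemma lebesgue_measure_translation (R : realType) (c : R) (A : set R) :
  measurable A ->
  pushforward lebesgue_measure (fun x : R => x + c : measurableTypeR R) A =
  lebesgue_measure A.
Proof.
have mT : measurable_fun setT (fun x : R => x + c : measurableTypeR R).
  exact: measurable_funD.
move=> mA; apply/esym/lebesgue_measure_unique => //= _ [[a b]] _ <-.
rewrite /pushforward (_ : _ @^-1` _ = `]a - c, b - c]%classic); last first.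
  by apply/seteqP; split => x /=; rewrite !in_itv/= ltrBlDr lerBrDr.
rewrite !lebesgue_measure_itv/= !lte_fin ltrBlDr subrK -!EFinB.
by rewrite (_ : b - c - (a - c) = b - a)//; ring.
Qed.

Lemma ge0_integral_translation (R : realType) (c a b : R) (f : R -> \bar R) :
  measurable_fun setT f -> (forall x, 0 <= f x)%E ->
  (\int[lebesgue_measure]_(x in `]a, b[) f (x + c)%R =
   \int[lebesgue_measure]_(x in `](a + c)%R, (b + c)%R[) f x)%E.
Proof.
move=> mf f0.
have mT : measurable_fun setT (fun x : R => x + c : measurableTypeR R).
  exact: measurable_funD.
rewrite (_ : `]a, b[%classic =
    (fun x : R => x + c : measurableTypeR R) @^-1` `](a + c), (b + c)[);
  last by apply/seteqP; split => x /=; rewrite !in_itv/= ltrD2r ltrD2r.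
apply: etrans (esym (@ge0_integral_pushforward _ _ (measurableTypeR R)
  (measurableTypeR R) R _ mT lebesgue_measure `](a + c), (b + c)[%classic f
  _ _ _)) _ => //; first exact: measurable_funS mf.
by apply: eq_measure_integral => //= A mA AS; exact: lebesgue_measure_translation.
Qed.

Section monotone_increment.
Context {R : realType}.
Variables (G : R -> R) (a b e : R).
Hypotheses (ab : a < b) (e0 : 0 < e) (G_nd : nondecreasing_fun G).
Hypotheses (Ga : forall x, 0 <= G x) (Gb : forall x, b <= x -> G x = G b).

Let mG (g : R -> R) : measurable_fun setT g ->
  measurable_fun setT (fun x => (G (g x))%:E).
Proof.
move=> mg; apply/measurable_EFinP; apply: measurableT_comp => //.
exact: nondecreasing_measurable.
Qed.

(** Translation by [e] turns the integral of [G (x + e)] into one over []a + e, b + e[]. This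
    interval lies in []a, b[] together with [[b, b + e[], and on the latter [G] is constant and
    contributes [e * G b]. *)
Lemma integral_increment_le :
  (\int[lebesgue_measure]_(x in `]a, b[) (G (x + e) - G x)%:E <= (e * G b)%:E)%E.
Proof.
set mu := lebesgue_measure.
have mshift : measurable_fun setT (fun x : R => x + e) by exact: measurable_funD.
have inc0 x : (0 <= (G (x + e) - G x)%:E)%E.
  by rewrite lee_fin subr_ge0; apply: G_nd; rewrite lerDl ltW.
have minc : measurable_fun setT (fun x : R => (G (x + e) - G x)%:E).
  under eq_fun do rewrite EFinB.
  by apply: emeasurable_funB; exact: mG.
have finI : (\int[mu]_(x in `]a, b[) (G x)%:E)%E \is a fin_num.
  rewrite ge0_fin_numE; last by apply: integral_ge0 => x _; rewrite lee_fin.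
  apply: (@le_lt_trans _ _ (\int[mu]_(x in `]a, b[) (cst (G b)%:E x))%E).
    apply: ge0_le_integral => //.
    - by move=> x _; rewrite lee_fin.
    - exact: measurable_funS (mG id _).
    - by move=> x /=; rewrite in_itv/= => /andP[_ /ltW xb]; rewrite lee_fin G_nd.
  rewrite integral_cst//= lebesgue_measure_itv/= lte_fin ab -EFinB -EFinM.
  exact: ltry.
(* Adding the finite integral of [G] to both sides removes the subtraction, so that only nonnegative
   integrands remain. *)
rewrite -(leeD2rE _ _ finI) -ge0_integralD//=; first last.
- exact: measurable_funS (mG id _).
- by move=> x _; rewrite lee_fin.
- exact: measurable_funS minc.
under eq_integral do rewrite -EFinD subrK.
rewrite (ge0_integral_translation R e a b (fun x => (G x)%:E)); first last.
- by move=> x; rewrite lee_fin.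
- exact: (mG id).
apply: (@le_trans _ _ (\int[mu]_(x in `]a, b[ `|` `[b, (b + e)%R[) (G x)%:E)%E).
  apply: ge0_subset_integral => //.
  - exact: measurableU.
  - exact: measurable_funS (mG id _).
  - by move=> x _; rewrite lee_fin.
  - move=> x /=; rewrite !in_itv/= => /andP[ax xb].
    case: (ltP x b) => xb'; [left|right]; rewrite ?xb ?andbT//.
    by apply: lt_trans ax; rewrite ltrDl.
rewrite ge0_integral_setU//=; first last.
- apply/disj_setPS => x /= []; rewrite !in_itv/= => /andP[_ xb] /andP[bx _].
  by move: (lt_le_trans xb bx); rewrite ltxx.
- by move=> x _; rewrite lee_fin.
- exact: measurable_funS (mG id _).
rewrite [leRHS]addeC leeD2l// (eq_integral (cst (G b)%:E)); last first.
  by move=> x; rewrite inE/= in_itv/= => /andP[bx _]; rewrite Gb.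
rewrite integral_cst//= lebesgue_measure_itv/= lte_fin ltrDl e0 -EFinB -EFinM.
by rewrite lee_fin addrAC subrr add0r mulrC.
Qed.

End monotone_increment.

Lemma limn_einf_le (R : realType) (u : (\bar R)^nat) (l : \bar R) :
  (forall n, u n <= l)%E -> (limn_einf u <= l)%E.
Proof.
move=> ul; rewrite limn_einf_lim; apply: lime_le; first exact: is_cvg_einfs.
apply: nearW => n; apply: le_trans (ul n).
by apply: ereal_inf_lbound; exists n => /=.
Qed.

(* Fatou's lemma applied to the difference quotients: one inequality of the
   fundamental theorem of calculus survives for functions that are only
   monotone. *)
Lemma integral_le_monotone (R : realType) (F h : R -> R) (a b : R) :
  a < b ->
  {in `[a, b]%R &, {homo F : x y / x <= y}} ->
  measurable_fun setT h -> (forall x, 0 <= h x) ->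
  {ae (lebesgue_measure : measure _ R), forall x, `]a, b[%classic x ->
     derivable F x 1 /\ h x <= 'D_1 F x} ->
  (\int[lebesgue_measure]_(x in `[a, b]) (h x)%:E <= (F b - F a)%:E)%E.
Proof.
move=> ab F_nd mh h0 hF.
(* Clamping to [[a, b]] extends [F] monotonically to the whole line, constant beyond [b];
   subtracting [F a] makes it nonnegative. This is the form needed for [integral_increment_le]. *)
pose cl x := Num.min b (Num.max a x).
have cl_in x : cl x \in `[a, b]%R.
  by rewrite in_itv/= /cl le_min ge_min le_max !lexx ltW//= .
have cl_id x : x \in `[a, b]%R -> cl x = x.
  rewrite in_itv/= /cl => /andP[ax xb].
  by rewrite (max_idPr ax); apply/min_idPr.
pose G x := F (cl x) - F a.
have G_nd : nondecreasing_fun G.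
  move=> x y xy; rewrite lerD2r; apply: F_nd => //.
  by rewrite /cl; apply: le_min2 => //; apply: le_max2.
have aab : a \in `[a, b]%R by rewrite in_itv/= lexx ltW.
have bab : b \in `[a, b]%R by rewrite in_itv/= lexx ltW.
have G0 x : 0 <= G x.
  rewrite subr_ge0; apply: F_nd => //.
  by have := cl_in x; rewrite in_itv => /andP[].
have Gb x : b <= x -> G x = G b.
  move=> bx; rewrite /G (cl_id b)// /cl.
  suff -> : Num.min b (Num.max a x) = b by [].
  by apply/min_idPl; rewrite le_max bx orbT.
have GbE : G b = F b - F a by rewrite /G cl_id.
rewrite integral_itv_bndoo; last first.
  by apply/measurable_EFinP; exact: measurable_funS mh.
pose e n : R := n.+1%:R^-1.
have e0 n : 0 < e n by rewrite invr_gt0.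
pose d n x := ((e n)^-1 * (G (x + e n) - G x))%:E.
have mGs n : measurable_fun setT (fun x : R => G (x + e n) - G x).
  apply: measurable_funB; last exact: nondecreasing_measurable.
  apply: (@measurableT_comp _ _ _ _ _ _ G); first exact: nondecreasing_measurable.
  exact: measurable_funD.
have md n : measurable_fun `]a, b[ (d n).
  apply: (@measurable_funS _ _ _ _ setT) => //.
  by apply/measurable_EFinP; exact: measurable_funM.
have mGd n : measurable_fun `]a, b[ (fun x : R => (G (x + e n) - G x)%:E).
  by apply: (@measurable_funS _ _ _ _ setT) => //; exact/measurable_EFinP.
have inc0 n x : 0 <= G (x + e n) - G x by rewrite subr_ge0 G_nd// lerDl ltW.
have d0 n x : (0 <= d n x)%E.
  by rewrite lee_fin mulr_ge0// invr_ge0 ltW.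
have intd n : (\int[lebesgue_measure]_(x in `]a, b[) d n x <= (F b - F a)%:E)%E.
  under eq_integral do rewrite /d EFinM.
  rewrite ge0_integralZl//=; first last.
  - by rewrite lee_fin invr_ge0 ltW.
  - by move=> x _; rewrite lee_fin.
  - exact: mGd.
  rewrite lee_pdivrMl// -GbE -EFinM.
  exact: integral_increment_le.
have mlim : measurable_fun `]a, b[ (fun x : R => limn_einf (d^~ x)).
  rewrite (_ : (fun x => _) = (fun x => - limn_esup (fun n => - d n x))%E).
    apply: (@measurableT_comp _ _ _ _ _ _ -%E) => //.
    apply: measurable_fun_limn_esup => n.
    exact: (@measurableT_comp _ _ _ _ _ _ -%E).
  apply/funext => x; rewrite -limn_einfN; congr limn_einf.
  by apply/funext => n; rewrite /comp oppeK.
apply: (@le_trans _ _ (\int[lebesgue_measure]_(x in `]a, b[) limn_einf (d^~ x))%E);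
  last first.
  apply: (le_trans (@fatou _ (measurableTypeR R) R lebesgue_measure
    `]a, b[%classic _ d md _)) => //.
  exact: limn_einf_le.
apply: ae_ge0_le_integral => //.
- by move=> x _; rewrite lee_fin.
- by apply: (@measurable_funS _ _ _ _ setT) => //; exact/measurable_EFinP.
- move=> x _; rewrite limn_einf_lim; apply: lime_ge; first exact: is_cvg_einfs.
  by apply: nearW => n; apply: le_ereal_inf_tmp => _ [m _ <-].
suff lim_ge x : `]a, b[%classic x -> derivable F x 1 /\ h x <= 'D_1 F x ->
    ((h x)%:E <= limn_einf (d^~ x))%E.
  have [N [mN N0 sN]] := hF; exists N; split => //.
  by apply: subset_trans sN => x; apply: contra_not => hx xab; exact/lim_ge/hx.
rewrite /= in_itv/= => /andP[ax xb] [dFx hFx].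
suff dcvg : d n x @[n --> \oo] --> ('D_1 F x)%:E.
  by rewrite is_cvg_limn_einfE ?(cvg_lim _ dcvg)//;
    apply/cvg_ex; exists ('D_1 F x)%:E.
apply/cvg_EFin; first by apply: nearW.
have e_cvg : e n @[n --> \oo] --> (0 : R)^'.
  move=> A wA.
  have wA' : \forall n \near \oo, e n != 0 -> A (e n) := @cvg_harmonic R _ wA.
  by apply: filterS wA' => n; apply; rewrite gt_eqF.
have := cvg_comp _ _ e_cvg dFx.
rewrite /=; apply: cvg_trans; apply: near_eq_cvg.
near=> n.
(* For large [n] both [x] and [x + e n] lie in [[a, b]], where clamping does nothing, so the
   quotients are those of [F]. *)
have xe : x + e n < b.
  rewrite -ltrBrDl; near: n.
  have : 0 < b - x by rewrite subr_gt0.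
  exact: (cvgr_lt _ (@cvg_harmonic R)).
rewrite /= /G !cl_id//; first last.
- by rewrite in_itv/= (ltW xe) ltW// ltr_wpDr// ltW.
- by rewrite in_itv/= (ltW xb) ltW.
by rewrite /GRing.scale/= mulr1 opprB addrA subrK (addrC x).
Unshelve. all: by end_near. Qed.

(** * The gap between a Bernstein function and the identity *)

(** Replaces a limit at the origin: derivatives are available only on the open half-line, so
    estimates start at a small [e] and carry an error [C * e]. If [B < A], some [e] makes this error
    at most half of [A - B]. *)
Lemma ler_of_small (R : realFieldType) (A B C x : R) : 0 < x ->
  (forall e, 0 < e -> e < x -> A <= B + C * e) -> A <= B.
Proof.
move=> x0 H; rewrite leNgt; apply/negP => BA.
have [C0|C0] := leP C 0.
  have := H (x / 2) ltac:(lra) ltac:(lra).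
  have : C * (x / 2) <= 0 by rewrite mulr_le0_ge0//; lra.
  lra.
set e := Num.min (x / 2) ((A - B) / (2 * C)).
have e0 : 0 < e by rewrite lt_min !divr_gt0//; lra.
have ex : e < x by rewrite gt_min; apply/orP; left; lra.
have : C * e <= (A - B) / 2.
  have : e <= (A - B) / (2 * C) by rewrite ge_min lexx orbT.
  rewrite -(ler_pM2l C0) => /le_trans; apply.
  by rewrite le_eqVlt; apply/orP; left; apply/eqP; field; lra.
have := H e e0 ex; lra.
Qed.

Lemma is_derive_ge0_le (R : realType) (f df : R -> R) (a b : R) : a <= b ->
  (forall x, a <= x -> x <= b -> is_derive x 1 f (df x)) ->
  (forall x, a <= x -> x <= b -> 0 <= df x) -> f a <= f b.
Proof.
move=> ab fdf df0.
have [|c|c cab] := @MVT_segment R f df a b ab.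
- by move=> x; rewrite in_itv/= => /andP[/ltW ? /ltW ?]; exact: fdf.
- apply: derivable_within_continuous => x; rewrite in_itv/= => /andP[ax xb].
  by have [] := fdf x ax xb.
- move: cab; rewrite in_itv/= => /andP[ac cb] E.
  by rewrite -subr_ge0 E mulr_ge0// ?df0// subr_ge0.
Qed.

Section gap_below_identity.
Context {R : realType}.
Variables f f1 f2 f3 : R -> R.
Hypothesis df0 : forall x : R, 0 < x -> is_derive x 1 f (f1 x).
Hypothesis df1 : forall x : R, 0 < x -> is_derive x 1 f1 (f2 x).
Hypothesis df2 : forall x : R, 0 < x -> is_derive x 1 f2 (f3 x).
Hypothesis f_ge0 : forall x : R, 0 < x -> 0 <= f x.
Hypothesis f1_ge0 : forall x : R, 0 < x -> 0 <= f1 x.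
Hypothesis f2_le0 : forall x : R, 0 < x -> f2 x <= 0.
Hypothesis f3_ge0 : forall x : R, 0 < x -> 0 <= f3 x.
Hypothesis f_le : forall x : R, 0 < x -> f x <= x.

Let f1_nonincreasing (x y : R) : 0 < x -> x <= y -> f1 y <= f1 x.
Proof.
move=> x0 xy; rewrite -lerN2.
apply: (is_derive_ge0_le _ (fun z => - f1 z) (fun z => - f2 z)) => // z xz _.
- have /df1 := lt_le_trans x0 xz; exact: is_deriveN.
- by rewrite oppr_ge0 f2_le0// (lt_le_trans x0).
Qed.

Let f2_nondecreasing (x y : R) : 0 < x -> x <= y -> f2 x <= f2 y.
Proof.
move=> x0 xy; apply: (is_derive_ge0_le _ f2 f3) => // z xz _.
- exact/df2/(lt_le_trans x0).
- exact/f3_ge0/(lt_le_trans x0).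
Qed.

(** By concavity [f z - f1 x * z] is nondecreasing in [z] up to [x], and near the origin it is at
    least [- f1 x * z]. Hence [f1 x * x <= f x <= x]. *)
Let f1_le1 (x : R) : 0 < x -> f1 x <= 1.
Proof.
move=> x0; rewrite -(ler_pM2r x0) mul1r.
apply: (@ler_of_small _ _ _ (f1 x) x) => // d d0 dx.
suff : f d - f1 x * d <= f x - f1 x * x.
  have := f_ge0 d d0; have := f_le x x0; lra.
apply: (is_derive_ge0_le _ (fun z => f z - f1 x * z) (fun z => f1 z - f1 x)).
- exact: ltW.
- move=> z dz _; have /df0 ? := lt_le_trans d0 dz.
  by apply: is_derive_eq; rewrite /GRing.scale/=; ring.
- by move=> z dz zx; rewrite subr_ge0 f1_nonincreasing// (lt_le_trans d0).
Qed.

(** Up to [x] the slope of [f1] is at most [f2 x], and near the origin [f1] is at most [1]. *)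
Let f1_le (x : R) : 0 < x -> f1 x <= 1 + x * f2 x.
Proof.
move=> x0; apply: (@ler_of_small _ _ _ (- f2 x) x) => // d d0 dx.
suff : f2 x * d - f1 d <= f2 x * x - f1 x.
  have := f1_le1 d d0; lra.
apply: (is_derive_ge0_le _ (fun z => f2 x * z - f1 z) (fun z => f2 x - f2 z)).
- exact: ltW.
- move=> z dz _; have /df1 ? := lt_le_trans d0 dz.
  by apply: is_derive_eq; rewrite /GRing.scale/=; ring.
- by move=> z dz zx; rewrite subr_ge0 f2_nondecreasing// (lt_le_trans d0).
Qed.

(** The expression has derivative [f1 x - 1 - x * f2 x], whose sign is [f1_le]; at a small [d] it is
    at most [d], because [f d <= d] and [0 <= f1 d]. *)
Let kle0 (x : R) : 0 < x -> 2 * f x - x - x * f1 x <= 0.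
Proof.
move=> x0; apply: (@ler_of_small _ _ _ 1 x) => // d d0 dx.
suff : d + d * f1 d - 2 * f d <= x + x * f1 x - 2 * f x.
  have := f_le d d0; have := mulr_ge0 (ltW d0) (f1_ge0 d d0); lra.
apply: (is_derive_ge0_le _ (fun z => z + z * f1 z - 2 * f z)
  (fun z => 1 + z * f2 z - f1 z)).
- exact: ltW.
- move=> z dz _; have z0 := lt_le_trans d0 dz.
  have ? := df0 z z0; have ? := df1 z z0.
  by apply: is_derive_eq; rewrite /GRing.scale/=; ring.
- by move=> z dz zx; rewrite subr_ge0 f1_le// (lt_le_trans d0).
Qed.

(* With [g x = x - f x], the third derivative of [g] being nonpositive makes
   [x g' - 2 g], the numerator of the derivative of [g x / x ^+ 2], nonincreasing
   from the value [0] at the origin. *)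
Lemma gap_nonincreasing (x y : R) : 0 < x -> x <= y ->
  (y - f y) / y ^+ 2 <= (x - f x) / x ^+ 2.
Proof.
move=> x0 xy; rewrite -lerN2.
apply: (is_derive_ge0_le _ (fun z => - ((z - f z) / z ^+ 2))
  (fun z => - ((2 * f z - z - z * f1 z) / z ^+ 3))) => // z xz _;
  have z0 := lt_le_trans x0 xz.
- have ? := df0 z z0.
  have zn0 : z ^+ 2 != 0 by rewrite expf_neq0// gt_eqF.
  have dsq : is_derive z 1 (fun y : R => y ^+ 2) (2 * z).
    by apply: is_derive_eq; rewrite /GRing.scale/=; ring.
  have dV := @is_deriveV R (fun y : R => y ^+ 2) z (2 * z) 1 zn0 dsq.
  apply: is_derive_eq; rewrite /GRing.scale/=.
  by field; rewrite gt_eqF.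
- by rewrite oppr_ge0 mulr_le0_ge0 ?kle0// invr_ge0 exprn_ge0// ltW.
Qed.

End gap_below_identity.

Section bernstein_facts.
Context {R : realType}.
Variable f : R -> R.
Hypothesis fB : bernstein f.

Let df (n : nat) (x : R) : 0 < x -> is_derive x 1 (derive1n n f) (derive1n n.+1 f x).
Proof.
case: fB => fd _ _ _ x0.
by rewrite /derive1n iterS derive1E; apply: derivableP; exact: fd.
Qed.

Lemma bernstein_homo (x y : R) : 0 < x -> x <= y -> f x <= f y.
Proof.
move=> x0 xy; apply: (is_derive_ge0_le _ f (derive1n 1 f)) => // z xz _.
- exact/(df 0)/(lt_le_trans x0).
- have z0 := lt_le_trans x0 xz.
  by case: fB => _ _ /(_ 1%N z isT z0) + _; rewrite mul1r.
Qed.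

Lemma bernstein_gap_nonincreasing (x y : R) : (forall x : R, 0 < x -> f x <= x) ->
  0 < x -> x <= y -> (y - f y) / y ^+ 2 <= (x - f x) / x ^+ 2.
Proof.
case: (fB) => _ f0 fn _ f_le.
have f1 (z : R) : 0 < z -> 0 <= derive1n 1 f z.
  by move=> z0; have := fn 1%N z isT z0; rewrite mul1r.
have f2 (z : R) : 0 < z -> derive1n 2 f z <= 0.
  by move=> z0; have := fn 2%N z isT z0; rewrite expr1 mulN1r oppr_ge0.
have f3 (z : R) : 0 < z -> 0 <= derive1n 3 f z.
  by move=> z0; have := fn 3%N z isT z0; rewrite sqrrN expr1n mul1r.
exact: (gap_nonincreasing _ _ _ _ (df 0) (df 1) (df 2) f0 f1 f2 f3 f_le).
Qed.

End bernstein_facts.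

(** * Complex derivatives at points of the real axis *)

Section real_restriction.
Context {R : realType}.
Local Notation C := ((R[i])^o).

Lemma Re_cvg (T : Type) (F : set_system T) {FF : Filter F} (f : T -> C) (l : C) :
  f @ F --> l -> complex.Re (f t) @[t --> F] --> complex.Re l.
Proof.
move=> fl; apply/cvgrPdist_lt => e e0.
have ec : (0 : C) < RtoC e by rewrite ltcE/= eqxx.
move/cvgrPdist_lt : fl => /(_ _ ec); apply: filterS => t.
rewrite ltcE/= => /andP[_]; apply: le_lt_trans.
have := normc_ge_Re (l - f t); rewrite lecE/= => /andP[_].
by case: l (f t) => a b [c d].
Qed.

Lemma RtoC_cvg0 : RtoC h @[h --> (0 : R)^'] --> (0 : C)^'.
Proof.
move=> A wA.
have RtoC0 : RtoC h @[h --> (0 : R)] --> (0 : C).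
  apply/cvgrPdist_lt => e e0.
  (* In the order of [R[i]] a positive element is real, so its real part can serve as radius. *)
  have [e_im e_re] : complex.Im e = 0 /\ 0 < complex.Re e.
    by move: e0; rewrite ltcE/= => /andP[/eqP -> ->].
  exists (complex.Re e) => // h; rewrite /ball_/= sub0r normrN => he.
  rewrite sub0r normrN ltcE/= e_im eqxx/=.
  by rewrite expr0n/= addr0 sqrtr_sqr.
have wA' : \forall h \near (0 : R), RtoC h != 0 -> A (RtoC h) := RtoC0 _ wA.
apply: filterS wA' => h wh h0; apply: wh.
by apply: contra_neq h0 => -[].
Qed.

(** The complex difference quotient keeps its limit along real increments, for which taking real
    parts commutes with the division by [h]. *)
Lemma is_derive_Re (f : C -> C) (x : R) : derivable f (RtoC x) 1 ->
  is_derive x 1 (fun y : R => complex.Re (f (RtoC y)))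
    (complex.Re ('D_1 f (RtoC x))).
Proof.
move=> df.
have FF : Filter (0 : R)^' by typeclasses eauto.
have Dcvg := @Re_cvg _ _ FF _ _ (cvg_comp _ _ RtoC_cvg0 df).
have {}Dcvg : h^-1 *: (complex.Re (f (RtoC (h *: 1 + x))) - complex.Re (f (RtoC x)))
    @[h --> (0 : R)^'] --> complex.Re ('D_1 f (RtoC x)).
  apply: cvg_trans Dcvg; apply: near_eq_cvg; near=> h => /=.
  have h0 : h != 0 by near: h; exact: nbhs_dnbhs_neq.
  have -> : (RtoC h *: 1 + RtoC x : C) = RtoC (h *: 1 + x).
    rewrite /GRing.scale/= !mulr1 /RtoC; apply/eqP.
    by rewrite eq_complex/= addr0 !eqxx.
  case: (f _) => a b; case: (f _) => c d; rewrite /GRing.scale/=.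
  by rewrite expr0n/= addr0 mul0r oppr0 mul0r subr0; field.
split; first by apply/cvg_ex; exists (complex.Re ('D_1 f (RtoC x))).
exact: cvg_lim.
Unshelve. all: by end_near. Qed.

End real_restriction.

Section second_derivative_at_infinity.
Context {R : realType}.
Local Notation C := ((R[i])^o).

(* Wherever the complex second derivative fails to exist, ['D_1] returns a junk
   value with real part [0]; so a positive limit at infinity forces genuine
   second derivatives far out on the real axis, and no regularity theory of
   holomorphic functions is needed. *)
Lemma phi2inf_le (phi : C -> R -> C) (s L : R) :
  holomorphic_on (@Hplane R) (phi^~ s) -> 0 <= L ->
  (forall A : R, exists2 w, A < w & complex.Re (phi (RtoC w) s) <= L * w ^+ 2) ->
  complex.Re (phi2inf phi s) <= 2 * L.
Proof.
move=> hol L0 smallL; rewrite leNgt; apply/negP => cL.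
set c := complex.Re (phi2inf phi s) in cL.
(* Without convergence [lim] would be a default value of real part [0], against [cL] and
   [0 <= L]. *)
have c_cvg : phi2 phi s (RtoC x) @[x --> +oo] --> phi2inf phi s.
  apply: contrapT => /dvgP E; move: cL; rewrite /c /phi2inf E /=; lra.
(* With [m] strictly between [2 * L] and [c], the second derivative eventually exceeds [m]. Two
   integrations bound [u y] below by [m / 2 * y ^+ 2] plus an affine term, which outgrows
   [L * y ^+ 2]. *)
pose m := (c + 2 * L) / 2.
have cm : m < c by rewrite /m; lra.
have mL : 2 * L < m by rewrite /m; lra.
pose u (y : R) := complex.Re (phi (RtoC y) s).
pose u1 (y : R) := complex.Re ('D_1 (phi^~ s) (RtoC y)).
pose u2 (y : R) := complex.Re (phi2 phi s (RtoC y)).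
have du (y : R) : 0 < y -> is_derive y 1 u (u1 y).
  by move=> y0; apply: is_derive_Re; exact: hol.
have [B B0 Bm] : exists2 B : R, 0 < B & forall y : R, B <= y -> m < u2 y.
  have [A [_ HA]] := cvgr_gt _ (Re_cvg _ _ _ _ c_cvg) _ cm.
  exists (Num.max A 0 + 1); first by rewrite ltr_wpDl// le_max lexx orbT.
  move=> y; rewrite -lerBrDr => yA; apply: HA.
  have : A <= Num.max A 0 by rewrite le_max lexx.
  lra.
have du1 (y : R) : B <= y -> is_derive y 1 u1 (u2 y).
  move=> By; apply: is_derive_Re; apply: contrapT => /dvgP E.
  have := Bm y By; rewrite /u2 /phi2 /derive E/=; lra.
pose K := u1 B - m * B.
have u1K (y : R) : B <= y -> K <= u1 y - m * y.
  move=> By; apply: (is_derive_ge0_le _ (fun z => u1 z - m * z)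
    (fun z => u2 z - m)) => //.
  - move=> z Bz _; have ? := du1 z Bz.
    by apply: is_derive_eq; rewrite /GRing.scale/=; ring.
  - by move=> z Bz _; rewrite subr_ge0 ltW// Bm.
pose K' := u B - m / 2 * B ^+ 2 - K * B.
have uK (y : R) : B <= y -> K' <= u y - m / 2 * y ^+ 2 - K * y.
  move=> By; apply: (is_derive_ge0_le _ (fun z => u z - m / 2 * z ^+ 2 - K * z)
    (fun z => u1 z - m * z - K)) => //.
  - move=> z Bz _; have ? := du z (lt_le_trans B0 Bz).
    by apply: is_derive_eq; rewrite /GRing.scale/=; field.
  - by move=> z Bz _; rewrite subr_ge0 u1K.
pose d := m / 2 - L.
have d0 : 0 < d by rewrite /d; lra.
(* Past this threshold the quadratic excess [d * w ^+ 2] dominates the affine term with coefficients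
   [K] and [K']. *)
have [w] := smallL (Num.max (Num.max B 1) ((`|K| + `|K'|) / d)).
rewrite !gt_max => /andP[/andP[Bw w1]]; rewrite ltr_pdivrMr// => wd uL.
have := uK w (ltW Bw); rewrite /u.
have : (`|K| + `|K'|) * w < d * w ^+ 2.
  by rewrite expr2 mulrA ltr_pM2r ?(lt_trans ltr01)// mulrC.
have : - (K * w) <= `|K| * w.
  by rewrite -mulNr ler_pM2r ?(lt_trans ltr01)// -normrN ler_norm.
have : - K' <= `|K'| * w.
  by rewrite (@le_trans _ _ `|K'|)//; [rewrite -normrN ler_norm|rewrite ler_peMr// ltW].
rewrite /d; lra.
Qed.

End second_derivative_at_infinity.

(** Provides terminal times just after [s] from a countable set, so that one null set can serve for
    all of them. *)
Lemma fraction_between (R : realType) (s d : R) : 0 <= s -> 0 < d ->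
  exists i j : nat, s <= i%:R / j.+1%:R < s + d.
Proof.
move=> s0 d0; pose j := Num.truncn d^-1.
have jd : d^-1 < j.+1%:R by rewrite /j; exact: truncnS_gt.
have j0 : (0 : R) < j.+1%:R by [].
exists (Num.truncn (s * j.+1%:R)).+1, j; apply/andP; split.
  by rewrite ler_pdivlMr// ltW// truncnS_gt.
rewrite ltr_pdivrMr// mulrDl -natr1 ler_ltD//.
  by rewrite truncn_le mulr_ge0.
by rewrite -ltr_pdivrMl// mulr1.
Qed.

(** * Members of [in_BF0] on the positive axis *)

Section exponents_on_the_real_axis.
Context {R : realType}.
Local Notation C := ((R[i])^o).

(** If [x < f x], monotonicity keeps all iterates of [x] above [x], against convergence to [0] on
    the one-point compact set at [x]. *)
Lemma DW_point_zero_le (w : C -> C) (f : R -> R) :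
  (forall x : R, 0 < x -> w (RtoC x) = RtoC (f x)) ->
  (forall x y : R, 0 < x -> x <= y -> f x <= f y) ->
  DW_point_zero w -> forall x : R, 0 < x -> f x <= x.
Proof.
move=> wf f_nd w0 x x0; rewrite leNgt; apply/negP => xf.
have iterE n : iter n w (RtoC x) = RtoC (iter n f x) /\ x <= iter n f x.
  elim: n => [//|n [IH1 IH2]]; rewrite !iterS IH1; split.
    by rewrite wf// (lt_le_trans x0).
  by apply: le_trans (ltW xf) _; exact: f_nd.
have K1 : [set RtoC x] `<=` @Hplane R by move=> _ ->.
have := w0 _ K1 (@compact_set1 _ _).
rewrite uniform_set1 => iter0.
have Re0 : complex.Re (iter n w (RtoC x)) @[n --> \oo] --> (0 : R).
  exact: (@Re_cvg _ _ _ _ _ _ iter0).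
have [n _ /(_ n (leqnn n))] := cvgr_lt _ Re0 _ x0.
by have [-> /= xn] := iterE n; rewrite ltNge xn.
Qed.

Lemma BF0_real (w : C -> C) : HolHH w -> in_BF0 w ->
  exists f : R -> R,
  [/\ forall x : R, 0 < x -> w (RtoC x) = RtoC (f x),
      forall x : R, 0 < x -> 0 < f x <= x,
      forall x y : R, 0 < x -> x <= y -> f x <= f y
    & forall x y : R, 0 < x -> x <= y ->
        (y - f y) / y ^+ 2 <= (x - f x) / x ^+ 2].
Proof.
move=> [_ wH] [wid|[[_ [f [fB wf]]] [_ w0]]].
  exists id; split => //.
  - by move=> x x0; exact: wid.
  - by move=> x x0; rewrite x0/=.
  - by move=> x y _ _; rewrite !subrr !mul0r.
have f_le := DW_point_zero_le _ _ wf (bernstein_homo _ fB) w0.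
exists f; split => //.
- by move=> x x0; rewrite f_le// andbT; have := wH (RtoC x) x0; rewrite wf.
- exact: bernstein_homo.
- by move=> x y x0 xy; exact: bernstein_gap_nonincreasing.
Qed.

End exponents_on_the_real_axis.

(** * Dependence of the exponents on the starting time *)

Section reverse_family.
Context {R : realType}.
Local Notation C := ((R[i])^o).
Variable v : R -> R -> C -> C.
Hypotheses (v_rev : reverse_evolution_family v).
Hypothesis v_BF0 : forall s t : R, 0 <= s -> s <= t -> in_BF0 (v s t).

Definition exponent (s t x : R) : R := complex.Re (v s t (RtoC x)).

Let v_real (s t : R) : 0 <= s -> s <= t -> exists f : R -> R,
  [/\ forall x : R, 0 < x -> v s t (RtoC x) = RtoC (f x),
      forall x : R, 0 < x -> 0 < f x <= x,
      forall x y : R, 0 < x -> x <= y -> f x <= f y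
    & forall x y : R, 0 < x -> x <= y ->
        (y - f y) / y ^+ 2 <= (x - f x) / x ^+ 2].
Proof.
move=> s0 st; apply: BF0_real; last exact: v_BF0.
by case: v_rev => + _ _; exact.
Qed.

Lemma exponentE (s t x : R) : 0 <= s -> s <= t -> 0 < x ->
  v s t (RtoC x) = RtoC (exponent s t x).
Proof.
by move=> s0 st x0; have [f [vf _ _ _]] := v_real _ _ s0 st; rewrite /exponent vf.
Qed.

Lemma exponent_gt0 (s t x : R) : 0 <= s -> s <= t -> 0 < x -> 0 < exponent s t x.
Proof.
move=> s0 st x0; have [f [vf f0 _ _]] := v_real _ _ s0 st.
by rewrite /exponent vf//=; case/andP : (f0 _ x0).
Qed.

Lemma exponent_le (s t x : R) : 0 <= s -> s <= t -> 0 < x -> exponent s t x <= x.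
Proof.
move=> s0 st x0; have [f [vf f0 _ _]] := v_real _ _ s0 st.
by rewrite /exponent vf//=; case/andP : (f0 _ x0).
Qed.

Lemma exponent_homo (s t x y : R) : 0 <= s -> s <= t -> 0 < x -> x <= y ->
  exponent s t x <= exponent s t y.
Proof.
move=> s0 st x0 xy; have [f [vf _ f_nd _]] := v_real _ _ s0 st.
by rewrite /exponent !vf//= ?f_nd// (lt_le_trans x0).
Qed.

Lemma exponent_gap (s t x y : R) : 0 <= s -> s <= t -> 0 < x -> x <= y ->
  (y - exponent s t y) / y ^+ 2 <= (x - exponent s t x) / x ^+ 2.
Proof.
move=> s0 st x0 xy; have [f [vf _ _ f_gap]] := v_real _ _ s0 st.
by rewrite /exponent !vf//= ?f_gap// (lt_le_trans x0).
Qed.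

Lemma exponent_comp (s t u x : R) : 0 <= s -> s <= t -> t <= u -> 0 < x ->
  exponent s u x = exponent s t (exponent t u x).
Proof.
move=> s0 st tu x0; case: v_rev => _ _ /(_ s t u (RtoC x) s0 st tu x0) E.
by rewrite {1}/exponent E exponentE// (le_trans s0).
Qed.

Lemma exponent_homo_start (s s' t x : R) : 0 <= s -> s <= s' -> s' <= t -> 0 < x ->
  exponent s t x <= exponent s' t x.
Proof.
move=> s0 ss' s't x0; rewrite (exponent_comp s s' t)//.
have s'0 := le_trans s0 ss'.
by apply: exponent_le => //; exact: exponent_gt0.
Qed.

(** For [h <= 0] the evolution property writes [exponent (h + s) t x] as [exponent (h + s) s]
    applied to [exponent s t x]. The left quotients therefore involve [t] and [x] only through the
    value [exponent s t x], which makes rates for different [t] and [x] comparable. *)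
Let rate_cvg (s t x : R) : 0 < s -> s <= t -> 0 < x ->
  derivable (fun r => exponent r t x) s 1 ->
  h^-1 * (exponent (h + s) s (exponent s t x) - exponent s t x) @[h --> 0^'-] -->
  'D_1 (fun r => exponent r t x) s.
Proof.
move=> s0 st x0 /cvg_dnbhs_at_left; apply: cvg_trans; apply: near_eq_cvg.
near=> h => /=.
have hs : 0 <= h + s.
  rewrite addrC -(opprK h) subr_ge0 ltW// ltrNl; near: h.
  by apply: nbhs_left_gt; rewrite oppr_lt0.
have hs' : h + s <= s by rewrite gerDr; near: h; exact: nbhs_left_le.
by rewrite /GRing.scale/= mulr1 (exponent_comp (h + s) s t).
Unshelve. all: by end_near. Qed.

Lemma rate_ge0 (s t x : R) : 0 < s -> s <= t -> 0 < x ->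
  derivable (fun r => exponent r t x) s 1 -> 0 <= 'D_1 (fun r => exponent r t x) s.
Proof.
move=> s0 st x0 dE.
apply: (ler_cvg_to (cvg_cst (0 : R)) (rate_cvg _ _ _ s0 st x0 dE)).
near=> h.
have hs : 0 <= h + s.
  rewrite addrC -(opprK h) subr_ge0 ltW// ltrNl; near: h.
  by apply: nbhs_left_gt; rewrite oppr_lt0.
have h0 : h <= 0 by near: h; exact: nbhs_left_le.
apply: mulr_le0; first by rewrite invr_le0.
rewrite subr_le0 exponent_le// ?gerDr//.
by apply: exponent_gt0 => //; exact: ltW.
Unshelve. all: by end_near. Qed.

(* The monotonicity of [(x - v x) / x ^+ 2] passes to the infinitesimal
   generator. *)
Lemma rate_compare (s t x t' x' : R) :
  0 < s -> s <= t -> 0 < x -> s <= t' -> 0 < x' ->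
  derivable (fun r => exponent r t x) s 1 ->
  derivable (fun r => exponent r t' x') s 1 ->
  exponent s t x <= exponent s t' x' ->
  'D_1 (fun r => exponent r t' x') s / exponent s t' x' ^+ 2 <=
  'D_1 (fun r => exponent r t x) s / exponent s t x ^+ 2.
Proof.
move=> s0 st x0 st' x'0 dE dE' ww'.
have w0 : 0 < exponent s t x by apply: exponent_gt0 => //; exact: ltW.
apply: (ler_cvg_to
  (cvgM (rate_cvg _ _ _ s0 st' x'0 dE') (cvg_cst (exponent s t' x' ^+ 2)^-1))
  (cvgM (rate_cvg _ _ _ s0 st x0 dE) (cvg_cst (exponent s t x ^+ 2)^-1))).
near=> h.
have hs : 0 <= h + s.
  rewrite addrC -(opprK h) subr_ge0 ltW// ltrNl; near: h.
  by apply: nbhs_left_gt; rewrite oppr_lt0.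
have h0 : h <= 0 by near: h; exact: nbhs_left_le.
rewrite -[X in X <= _]mulrA -[X in _ <= X]mulrA ler_wnM2l ?invr_le0//.
rewrite -lerN2 -!mulNr !opprB; apply: exponent_gap => //.
by rewrite gerDr.
Unshelve. all: by end_near. Qed.

(** * The Herglotz equation and its integrated form *)

Hypothesis v_ac : abs_cont_family v.

(** Continuity in the terminal time at [t = s], where the exponent is the identity. It shows that
    exponents with terminal time just after [s] take arbitrarily large values. *)
Lemma exponent_near (s x e : R) : 0 <= s -> 0 < x -> 0 < e ->
  exists2 d, 0 < d & forall t, s <= t -> t < s + d -> x - e < exponent s t x.
Proof.
move=> s0 x0 e0; have [f [f0 fint fv]] := v_ac (RtoC x) x0.
have intf : lebesgue_measure.-integrable `[s, s + 1] (EFin \o f).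
  apply: integrableS (fint (s + 1) _) => //; last by rewrite addr_ge0.
  by apply: subset_itvr; rewrite bnd_simp.
have := @parameterized_integral_near_left R s (s + 1) e f _ e0 intf.
rewrite ltrDl ltr01 => /(_ isT) [d /= d0 near_s].
exists (Num.min d 1); first by rewrite lt_min d0 ltr01.
move=> t st; rewrite -ltrBlDl lt_min => /andP[td t1].
have := near_s t; rewrite /ball_/= distrC ger0_norm ?subr_ge0// => /(_ td st) int_lt.
have := fv s s t s0 (lexx s) st.
have intft : lebesgue_measure.-integrable `[s, t] (EFin \o f).
  apply: integrableS intf => //.
  by apply: subset_itvl; rewrite bnd_simp -lerBlDl ltW.
rewrite -(@fineK _ (\int[_]_(_ in _) _)%E); last first.
  by apply: integrable_fin_num.
rewrite lee_fin => /le_lt_trans/(_ (le_lt_trans (ler_norm _) int_lt)).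
rewrite exponentE//; case: v_rev => _ -> // _.
rewrite /RtoC/= subrr expr0n/= addr0 sqrtr_sqr.
by rewrite ltr_norml => /andP[+ _]; lra.
Qed.

Variable phi : C -> R -> C.
Hypothesis v_phi : assoc_herglotz v phi.

(** The exceptional null set of the equation depends on the terminal time and the point, so [t] and
    [x] are joined by countably many pairs only: fractions and positive integers. Outside the union
    of these null sets, such pairs reach arbitrarily large values [w] at time [s]; there
    [rate_compare] bounds [phi (w, s) / w ^+ 2] by the rate for [t] and [x], as [phi2inf_le]
    requires. *)
Lemma phi2inf_le_rate (t x : R) : 0 <= t -> 0 < x ->
  {ae (lebesgue_measure : measure _ R), forall s, `]0, t[%classic s ->
    [/\ derivable (fun r => exponent r t x) s 1,
        0 <= 'D_1 (fun r => exponent r t x) s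
      & complex.Re (phi2inf phi s) <=
        2 * ('D_1 (fun r => exponent r t x) s / exponent s t x ^+ 2)]}.
Proof.
move=> t0 x0; case: v_phi => hol ode.
pose good (t x s : R) := `[0, t]%classic s ->
  derivable (fun r => exponent r t x) s 1 /\
  'D_1 (fun r => exponent r t x) s = complex.Re (phi (RtoC (exponent s t x)) s).
have ae_good (t' x' : R) : 0 <= t' -> 0 < x' ->
    {ae (lebesgue_measure : measure _ R), forall s, good t' x' s}.
  move=> t'0 x'0; have := ode t' (RtoC x') t'0 x'0.
  move=> [N [mN N0 sN]]; exists N; split => //.
  apply: subset_trans sN => s; apply: contra_not => H s0t.
  have [d1 _ d2 _] := H s0t; split => //.
  by rewrite -exponentE//; move: s0t; rewrite /= in_itv/= => /andP[].
have ae_all : {ae (lebesgue_measure : measure _ R), forall s, good t x s /\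
    forall k i j : nat, good (i%:R / j.+1%:R) k.+1%:R s}.
  have A1 := ae_good t x t0 x0.
  have A2 : {ae (lebesgue_measure : measure _ R),
      forall s (k i j : nat), good (i%:R / j.+1%:R) k.+1%:R s}.
    apply: (@ae_foralln _ (measurableTypeR R) R lebesgue_measure) => k.
    apply: (@ae_foralln _ (measurableTypeR R) R lebesgue_measure) => i.
    apply: (@ae_foralln _ (measurableTypeR R) R lebesgue_measure) => j.
    by apply: ae_good.
  exact: (@filterI _ _ (@ae_filter_ringOfSetsType _ (measurableTypeR R) R
    lebesgue_measure)).
case: ae_all => N [mN N0 sN]; exists N; split => //.
apply: subset_trans sN => s; apply: contra_not => -[good_t good_all] s0t.
move: (s0t); rewrite /= in_itv/= => /andP[s0 /ltW st].
have s0' := ltW s0.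
have [dE DE] : derivable (fun r => exponent r t x) s 1 /\
    'D_1 (fun r => exponent r t x) s = complex.Re (phi (RtoC (exponent s t x)) s).
  by apply: good_t; rewrite /= in_itv/= s0'.
have D0 := rate_ge0 _ _ _ s0 st x0 dE.
split => //.
have w0 := exponent_gt0 _ _ _ s0' st x0.
apply: phi2inf_le.
- exact: hol.
- by rewrite divr_ge0// exprn_ge0// ltW.
move=> A.
(* The starting point [k.+2] loses less than [1] under a short evolution, so its image exceeds
   [k.+1], hence both [A] and [exponent s t x]. *)
pose k := Num.truncn (Num.max A (exponent s t x)).
have kA : Num.max A (exponent s t x) < k.+1%:R by exact: truncnS_gt.
have k0 : (0 : R) < k.+2%:R by [].
have [d d0 near_s] := exponent_near s k.+2%:R 1 s0' k0 ltr01.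
have [i [j /andP[si id]]] := fraction_between _ s d s0' d0.
have big := near_s _ si id.
have kE : k.+2%:R - 1 = k.+1%:R :> R by rewrite -natr1 addrK.
rewrite kE in big.
have [Aw ww'] : A < exponent s (i%:R / j.+1%:R) k.+2%:R /\
    exponent s t x <= exponent s (i%:R / j.+1%:R) k.+2%:R.
  by move: (lt_trans kA big); rewrite gt_max => /andP[-> /ltW].
exists (exponent s (i%:R / j.+1%:R) k.+2%:R) => //.
have s0ij : `[0, i%:R / j.+1%:R]%classic s by rewrite /= in_itv/= s0'.
have [dE' DE'] := good_all k.+1 i j s0ij.
rewrite -DE' -ler_pdivrMr; last by rewrite exprn_gt0// exponent_gt0.
exact: rate_compare.
Qed.

(** The measurable [h] stands in for [phi2inf phi]. The maximum with [0] costs nothing, since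
    [- 2 / exponent r t x] has a nonnegative derivative in [r] wherever the equation holds. *)
Lemma integral_le_inv_exponent (h : R -> R) (s t x : R) :
  measurable_fun setT h -> (forall r, 0 <= h r) ->
  (forall r, 0 <= r -> h r <= Num.max 0 (complex.Re (phi2inf phi r))) ->
  0 <= s -> s <= t -> 0 < x ->
  (\int[lebesgue_measure]_(r in `[s, t]) (h r)%:E <=
   (2 * (exponent s t x)^-1)%:E)%E.
Proof.
move=> mh h0 hphi s0; rewrite le_eqVlt => /predU1P[<-|st] x0.
  rewrite set_itv1 integral_set1 lee_fin mulr_ge0// invr_ge0 ltW//.
  exact: exponent_gt0.
have t0 := le_trans s0 (ltW st).
pose F (r : R) : R := - 2 * (exponent r t x)^-1.
have E0 r : s <= r -> r <= t -> 0 < exponent r t x.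
  by move=> sr rt; apply: exponent_gt0 => //; exact: le_trans sr.
apply: (@le_trans _ _ (F t - F s)%:E); last first.
  rewrite lee_fin /F !mulNr opprK addrC gerBl mulr_ge0// invr_ge0.
  by rewrite ltW// E0// ltW.
apply: integral_le_monotone => //.
  move=> r r'; rewrite !in_itv/= => /andP[sr rt] /andP[sr' r't] rr'.
  rewrite /F !mulNr lerN2 ler_pM2l// lef_pV2 ?posrE ?E0//.
  by apply: exponent_homo_start => //; exact: le_trans sr.
have [N [mN N0 sN]] := phi2inf_le_rate t x t0 x0; exists N; split => //.
apply: subset_trans sN => r; apply: contra_not => H srt.
have : `]0, t[%classic r.
  by move: srt; rewrite /= !in_itv/= => /andP[sr ->]; rewrite (le_lt_trans s0 sr).
move=> /H [dE DE0 phiD].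
move: srt; rewrite /= in_itv/= => /andP[sr rt].
have Er0 := E0 r (ltW sr) (ltW rt).
have dV := @is_deriveV R (fun r => exponent r t x) r _ 1
  (lt0r_neq0 Er0) (derivableP dE).
have dF : is_derive r 1 F
    (2 * ('D_1 (fun r => exponent r t x) r / exponent r t x ^+ 2)).
  apply: is_derive_eq; rewrite /GRing.scale/=; ring.
split; first by case: dF.
case: dF => _ ->; apply: le_trans (hphi r (le_trans s0 (ltW sr))) _.
by rewrite ge_max phiD andbT mulr_ge0// divr_ge0// exprn_ge0// ltW.
Qed.

(** * Divergence of the integral and vanishing of the exponents *)

Hypothesis phi_dvg :
  (\int[lebesgue_measure]_(t in `[0%R, +oo[) (complex.Re (phi2inf phi t))%:E
     = +oo)%E.

Import HBNNSimple.

(* [phi2inf] need not be measurable, but the integral of its positive part is a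
   supremum over measurable simple minorants. *)
Lemma phi2inf_minorant (M : R) : exists h : R -> R,
  [/\ measurable_fun setT h, forall r, 0 <= h r,
      forall r, 0 <= r -> h r <= Num.max 0 (complex.Re (phi2inf phi r))
    & (M%:E < \int[lebesgue_measure]_(r in `[0%R, +oo[) (h r)%:E)%E].
Proof.
pose f (r : R) : \bar R := (complex.Re (phi2inf phi r))%:E.
have fpos : (\int[lebesgue_measure]_(r in `[0%R, +oo[) f^\+ r = +oo)%E.
  move: phi_dvg; rewrite integralE => Hy.
  apply/eqP; rewrite -leye_eq -Hy; apply: geeDl; rewrite oppe_le0.
  by apply: integral_ge0 => r _; exact: funeneg_ge0.
have : (M%:E < \int[lebesgue_measure]_(r in `[0%R, +oo[) f^\+ r)%E.
  by rewrite fpos ltry.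
rewrite ge0_integralE// => /ereal_sup_gt[_ [h hf <-] Mh].
have {}hf (r : R) : ((h r)%:E <= (f^\+ \_ `[0%R, +oo[) r)%E := hf r.
have mh : measurable_fun setT (h : R -> R) := @measurable_funPT _ _ _ _ h.
exists h; split => //.
- move=> r r0; have := hf r; rewrite patchE mem_set/=; last by rewrite in_itv/= r0.
  by rewrite funeposE -EFin_max lee_fin maxC.
(* Off the half-line the bound [hf] forces [h] to vanish, so integrating over the whole line changes
   nothing. *)
- apply: lt_le_trans Mh _; rewrite -integralT_nnsfun.
  rewrite [leRHS]integral_mkcond le_eqVlt; apply/orP; left; apply/eqP.
  apply: eq_integral => r _; have := hf r; rewrite !patchE; case: ifPn => // _.
  by rewrite lee_fin => hr; congr EFin; apply/eqP; rewrite eq_le hr fun_ge0.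
Qed.

(** Of an integral over [[0, t]] exceeding [C0 + 2 / e], the part over [[0, s]] is at most [C0], by
    the integrated bound at the point [1]. The part over [[s, t]] is at most [2 / exponent s t x],
    which must then be at least [2 / e]. The choice of [T] does not involve [x]. *)
Lemma exponent_vanishes (s e : R) : 0 <= s -> 0 < e ->
  exists2 T : R, s <= T & forall t x : R, T <= t -> 0 < x -> exponent s t x <= e.
Proof.
move=> s0 e0; pose C0 := 2 * (exponent 0 s 1)^-1.
have [h [mh h0 hphi hM]] := phi2inf_minorant (C0 + 2 * e^-1).
have mhE : measurable_fun setT (fun r => (h r)%:E) by exact/measurable_EFinP.
have [n hn] : exists n : nat,
    ((C0 + 2 * e^-1)%:E < \int[lebesgue_measure]_(r in `[0%R, n%:R]) (h r)%:E)%E.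
  by move: hM; rewrite ge0_integral_ereal_sup// => /ereal_sup_gt[_ [n _ <-]];
    exists n.+1.
exists (Num.max s n%:R); first by rewrite le_max lexx.
move=> t x; rewrite ge_max => /andP[st nt] x0.
have E0 : 0 < exponent s t x by exact: exponent_gt0.
rewrite -lef_pV2 ?posrE// -(ler_pM2l (ltr0Sn _ 1)) -(lerD2l C0) -lee_fin.
apply: le_trans (ltW hn) _.
apply: (@le_trans _ _
  (\int[lebesgue_measure]_(r in `[0%R, s] `|` `]s, t]) (h r)%:E)%E).
  apply: ge0_subset_integral => //.
  - exact: measurableU.
  - exact: measurable_funS mhE.
  - by move=> r _; rewrite lee_fin.
  - move=> r /=; rewrite !in_itv/= => /andP[r0 rn].
    by case: (leP r s) => rs; [left|right]; rewrite ?r0//= (le_trans rn).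
rewrite ge0_integral_setU//=; first last.
- apply/disj_setPS => r /= []; rewrite !in_itv/= => /andP[_ rs] /andP[sr _].
  by move: (le_lt_trans rs sr); rewrite ltxx.
- by move=> r _; rewrite lee_fin.
- exact: measurable_funS mhE.
rewrite EFinD leeD//; first exact: integral_le_inv_exponent.
rewrite (@integral_itv_obnd_cbnd R); last exact: measurable_funS mhE.
exact: integral_le_inv_exponent.
Qed.

Lemma vinf_le (s t e : R) : 0 <= s -> s <= t ->
  (forall x : R, 0 < x -> exponent s t x <= e) -> (0 <= vinf v s t <= e%:E)%E.
Proof.
move=> s0 st Ee.
have E_cvg : cvg ((exponent s t x)%:E @[x --> +oo]).
  (* Monotonicity in [x] is known on the positive axis only; cutting off at [1] gives a function
     monotone on the whole line with the same behaviour at infinity. *)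
  have /nondecreasing_is_cvge E1 :
      nondecreasing_fun (fun x => (exponent s t (Num.max 1 x))%:E).
    move=> x y xy; rewrite lee_fin exponent_homo//.
      by rewrite lt_max ltr01.
    exact: le_max2.
  move/cvg_ex : E1 => [l El]; apply/cvg_ex; exists l.
  apply: cvg_trans El; apply: near_eq_cvg; near=> x; congr EFin.
  congr exponent; apply/max_idPr; near: x; exact: nbhs_pinfty_ge.
rewrite /vinf; apply/andP; split.
  apply: lime_ge => //; near=> x; rewrite lee_fin ltW//.
  have x0 : 0 < x by near: x; exact: nbhs_pinfty_gt.
  exact: exponent_gt0.
apply: lime_le => //; near=> x; rewrite lee_fin; apply: Ee.
near: x; exact: nbhs_pinfty_gt.
Unshelve. all: by end_near. Qed.

Lemma vinf_cvg0 (s : R) : 0 <= s -> vinf v s t @[t --> +oo] --> 0%E.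
Proof.
move=> s0; have bound (e : R) : 0 < e ->
    \forall t \near +oo, (0 <= vinf v s t <= e%:E)%E.
  move=> e0; have [T sT ET] := exponent_vanishes s e s0 e0.
  near=> t; have Tt : T <= t by near: t; apply: nbhs_pinfty_ge; rewrite num_real.
  apply: (vinf_le _ _ _ s0 (le_trans sT Tt)).
  by move=> x; exact: ET.
have fin t e : (0 <= vinf v s t <= e%:E)%E -> vinf v s t \is a fin_num.
  move=> /andP[v0 ve]; rewrite ge0_fin_numE//.
  by apply: le_lt_trans ve _; exact: ltry.
apply/fine_cvgP; split.
  by apply: filterS (bound 1 ltr01) => t; exact: fin.
apply/cvgrPdist_le => e e0; apply: filterS (bound e e0) => t /[dup] vt.
rewrite -(fineK (fin _ _ vt)) !lee_fin => /andP[v0 ve] /=.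
by rewrite sub0r normrN ger0_norm.
Unshelve. all: by end_near. Qed.

End reverse_family.

(** * Laplace transforms and extinction *)

(** Along [theta = n.+1] the integrands decrease on [[0, +oo[] to the indicator of [0] and are
    dominated by [1], so the transforms converge to the mass at [0]. *)
Lemma laplace_mass0_ge (R : realType) 
    (mu : {measure set (\bar R) -> \bar R}) (g : R -> R) (b : R) :
  (mu setT < +oo)%E ->
  (forall theta : R, 0 < theta ->
    (\int[mu]_(y in [set y : \bar R | (0 <= y < +oo)%E])
       (expR (- (theta * fine y)))%:E = (expR (- g theta))%:E)%E) ->
  (forall theta : R, 0 < theta -> g theta <= b) ->
  ((expR (- b))%:E <= mu [set 0%E])%E.
Proof.
move=> muT lap gb; set D : set (\bar R) := [set y | (0 <= y < +oo)%E].
have mD : measurable D.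
  rewrite (_ : D = `[0%E, +oo%E[%classic); first exact: emeasurable_itv.
  by apply/seteqP; split => y /=; rewrite in_itv.
pose f (n : nat) (y : \bar R) := (expR (- (n.+1%:R * fine y)))%:E.
have mf n : measurable_fun D (f n).
  apply/measurable_EFinP/measurableT_comp => //.
  apply: measurableT_comp => //; exact: measurable_funM.
have f_cvg : {ae mu, forall y, D y -> f^~ y @ \oo --> (\1_[set 0%E] y : R)%:E}.
  apply: aeW => -[r| |]; rewrite /D/= ?ltxx ?andbF// => /andP[r0 _].
  apply/cvg_EFin; first exact: nearW.
  move: r0; rewrite le_eqVlt => /predU1P[[<-]|r0].
    rewrite indicE mem_set//=; apply: cvg_near_cst; apply: nearW => n.
    by rewrite /comp/= mulr0 oppr0 expR0.
  rewrite indicE memNset/=; last by move=> [r00]; move: r0; rewrite r00 ltxx.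
  rewrite (_ : _ \o _ = fun n => expR (- r) ^+ n.+1); last first.
    by apply/funext => n; rewrite /comp/= -expRM_natl mulrN.
  rewrite (cvg_shiftS (fun n => expR (- r) ^+ n)); apply: cvg_expr.
  by rewrite ger0_norm ?expR_ge0// expR_lt1 oppr_lt0.
have f_int : mu.-integrable D (cst 1%E).
  apply/integrableP; split => //; rewrite (eq_integral (cst 1%E)).
    rewrite integral_cst// mul1e; apply: le_lt_trans muT.
    by apply: le_measure; rewrite ?inE.
  by move=> y _; rewrite /= normr1.
have f_dom : {ae mu, forall y n, D y -> (`|f n y| <= cst 1%E y)%E}.
  apply: aeW => y n /andP[y0 _]; rewrite /= lee_fin ger0_norm ?expR_ge0//.
  by rewrite -[leRHS]expR0 ler_expR oppr_le0 mulr_ge0// fine_ge0.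
have m1 : measurable_fun D (fun y => (\1_[set 0%E] y : R)%:E).
  by apply/measurable_EFinP; exact: measurable_indic.
have [_ _ int_cvg] := dominated_convergence mD mf m1 f_cvg f_int f_dom.
rewrite integral_indic//= setIidl in int_cvg; last first.
  by move=> y ->; rewrite /D/= lexx ltry.
have <- := cvg_lim _ int_cvg => //.
apply: lime_ge; first by apply/cvg_ex; exists (mu [set 0%E]).
apply: nearW => n /=; rewrite lap// lee_fin ler_expR lerN2.
exact: gb.
Qed.

Section extinction.
Context {R : realType} {d : measure_display} {Omega : measurableType d}.
Variables (P : R -> \bar R -> probability Omega R) (Z : R -> Omega -> \bar R).
Variable v : R -> R -> (R[i])^o -> (R[i])^o.
Hypothesis ZP : branching_process P Z v.

(** The Markov property at time [s] itself, with the full event, identifies the probability as the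
    kernel mass at [0], because [Z s] equals [x] almost surely. *)
Lemma extinct_prob_ge (s t x b : R) : 0 <= s -> s <= t -> 0 <= x ->
  (forall theta : R, 0 < theta -> exponent v s t theta <= b) ->
  ((expR (- (x * b)))%:E <= P s x%:E (Z t @^-1` [set 0%E]))%E.
Proof.
move=> s0 st x0 vb; have [k [lap _ [mZ Zs] markov _]] := ZP.
have m0 : measurable [set 0%E : \bar R] by exact: emeasurable_set1.
have genT : <<s nat_gen Z s s >> setT.
  by move=> G [[G0 GC _] _]; rewrite -(setD0 setT); exact: GC.
have := markov s s t x%:E setT _ s0 (lexx s) st _ genT m0.
rewrite lee_fin setTI => -> //.
have mZx : measurable (Z s @^-1` [set x%:E]).
  by rewrite -(setTI (_ @^-1` _)); apply: mZ => //; exact: emeasurable_set1.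
have Zae : ae_eq (P s x%:E) setT (fun w => k s t (Z s w) [set 0%E])
    (cst (k s t x%:E [set 0%E])).
  exists (~` (Z s @^-1` [set x%:E])); split.
  - exact: measurableC.
  - have := Zs s x%:E s0; rewrite lee_fin => /(_ x0) Zs1.
    by apply: etrans (probability_setC _ mZx) _; rewrite Zs1 subee.
  - by move=> w /=; apply: contra_not => -> _.
rewrite (ae_eq_integral (cst (k s t x%:E [set 0%E])))//; last first.
  exact: (measurableT_comp (measurable_kernel (k s t) _ m0) (mZ s s0)).
rewrite integral_cst// [X in (_ * X)%E](_ : _ = 1%E) ?mule1//; last first.
  exact: probability_setT.
apply: (laplace_mass0_ge _ _ (fun theta => x * exponent v s t theta)).
- by rewrite [ltLHS](prob_kernel x%:E) ltry.
- by move=> theta theta0; rewrite lap.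
- by move=> theta theta0; rewrite ler_wpM2l// vb.
Qed.

(** Absorption at [0] lets extinction be observed at the times [s + n%:R], which exhibits the event
    as a countable union of measurable sets. *)
Lemma extinction_setE (s : R) : 0 <= s ->
  [set w | (extinction_time Z s w < +oo)%E] =
  \bigcup_n (Z (s + n%:R) @^-1` [set 0%E]).
Proof.
move=> s0; have [k [_ _ _ _ path]] := ZP.
apply/seteqP; split => w /=.
  move=> /ereal_inf_lt[_ [r [sr Zr] <-] _].
  have [_ _ _ absorbed _] := path w.
  exists (Num.truncn (r - s)).+1 => //=.
  apply: (absorbed r) => //; first exact: le_trans sr.
    by left.
  by rewrite -lerBlDl ltW// truncnS_gt.
move=> [n _ Zn]; apply: le_lt_trans (ltry (s + n%:R)).
by apply: ereal_inf_lbound; exists (s + n%:R) => //; split; rewrite ?lerDl.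
Qed.

Lemma extinction_almost_sure (s x : R) : 0 <= s -> 0 < x ->
  (forall e : R, 0 < e -> exists2 T : R, s <= T &
     forall t theta : R, T <= t -> 0 < theta -> exponent v s t theta <= e) ->
  P s x%:E [set w | (extinction_time Z s w < +oo)%E] = 1%E.
Proof.
move=> s0 x0 vanish; rewrite extinction_setE//.
have [k [_ _ [mZ _] _ _]] := ZP.
have mZn n : measurable (Z (s + n%:R) @^-1` [set 0%E]).
  by rewrite -(setTI (_ @^-1` _)); apply: mZ => //; rewrite addr_ge0.
set S := \bigcup_n _; have mS : measurable S by exact: bigcup_measurable.
apply/eqP; rewrite eq_le probability_le1//=; apply/lee_addgt0Pr => e e0.
(* The level [e / x] turns the bound into [expR (- e)], which is at least [1 - e]. *)
have [T sT ET] := vanish (e / x) (divr_gt0 e0 x0).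
pose n := (Num.truncn (T - s)).+1.
have Tn : T <= s + n%:R by rewrite -lerBlDl ltW// truncnS_gt.
rewrite -leeBlDr//; apply: (@le_trans _ _ (P s x%:E (Z (s + n%:R) @^-1` [set 0%E]))).
  apply: le_trans (extinct_prob_ge s (s + n%:R) x (e / x) s0 _ (ltW x0) _).
  - rewrite -EFinB lee_fin mulrCA divff ?gt_eqF// mulr1.
    by apply: le_trans (expR_ge1Dx _).
  - exact: le_trans Tn.
  - by move=> theta; exact: ET.
apply: le_measure; rewrite ?inE//.
by move=> w Zw; exists n.
Qed.

End extinction.

Theorem mainTheorem11 (R : realType) (v : R -> R -> (R[i])^o -> (R[i])^o)
    (phi : (R[i])^o -> R -> (R[i])^o) :
  reverse_evolution_family v ->
  abs_cont_family v ->
  (forall s t, 0 <= s -> s <= t -> in_BF0 (v s t)) ->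
  assoc_herglotz v phi ->
  (\int[lebesgue_measure]_(t in `[0%R, +oo[) (complex.Re (phi2inf phi t))%:E
     = +oo)%E ->
  (forall s, 0 <= s -> vinf v s t @[t --> +oo] --> 0%E) /\
  (forall d (Omega : measurableType d)
          (P : R -> \bar R -> probability Omega R) (Z : R -> Omega -> \bar R),
     branching_process P Z v ->
     forall s (x : R), 0 <= s -> 0 < x ->
       P s x%:E [set w | (extinction_time Z s w < +oo)%E] = 1%E).
Proof.
move=> v_rev v_ac v_BF0 v_phi phi_dvg; split.
  exact: (vinf_cvg0 _ v_rev v_BF0 v_ac _ v_phi phi_dvg).
move=> d Omega P Z ZP s x s0 x0; apply: (extinction_almost_sure _ _ _ ZP) => // e.
exact: (exponent_vanishes _ v_rev v_BF0 v_ac _ v_phi phi_dvg).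
Qed.
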